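(* Consider the following assertions, each for all integers $1\le l<m$, all prime powers $q$ and all admissible $r$ (with $k=\binom ml$): (Q1) $d_r$ is a sum of $r$ monomials of type $q^i$, for $r=1,\dots,k$. (Q2) $\Delta_r$ is a monomial of the form $q^i$. (Q3) $\Delta_r(q)=q^{l(m-l)}\Delta_{k+1-r}(q^{-1})$, where $\Delta_r=\Delta_r(q)$ is regarded as a polynomial in $q$. (Q4) If $H_r$ is computed by a linear section $H$ of $G(l,m)$, then $H_{k-r}$ is computed by $D(H)$. (Q5) $J_r=H_r$ (hence $D_r=d_r$ and $E_r=\Delta_r$). (Q7) $E_r$ is a monomial of the form $q^i$. (Q8) If $J_r$ is computed by a Schubert union $S_U$, then $J_{k-r}$ is computed by the dual Schubert union $S_{U^*}$. (Q9) $E_r(q)=q^{l(m-l)}E_{k+1-r}(q^{-1})$, where $E_r=E_r(q)$ is regarded as a polynomial in $q$. Then none of the assertions (Q7), (Q8), (Q9) always holds, and the assertions (Q1), (Q2), (Q3), (Q4), (Q5) do not all hold simultaneously for all $l,m,r,q$.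
   Context: Let $V$ be an $m$-dimensional vector space over $F_q$ with basis $e_1,\dots,e_m$ and $A_i=\mathrm{Span}(e_1,\dots,e_i)$. $G(l,m)$ is the Grassmann variety of $l$-dimensional subspaces of $V$, in its Plücker embedding in $\mathbf P^{k-1}$; $n$ is its number of $F_q$-points. The Grassmann code $C(l,m)$ is the $[n,k]$-code over $F_q$ whose generator matrix has as columns representatives of the $n$ points of $G(l,m)$. $d_r$ is its $r$-th higher weight (minimum cardinality of the support of an $r$-dimensional subcode), $d_0=0$; $H_r=n-d_r$ is the maximum number of $F_q$-points of $G(l,m)$ contained in a codimension $r$ linear subspace of $\mathbf P^{k-1}$; $\Delta_r=d_r-d_{r-1}$. $H_r$ is computed by a linear section $H=G(l,m)\cap\Lambda$ if $\Lambda$ has codimension $r$ and $H$ has $H_r$ points. For $\alpha=(a_1,\dots,a_l)$ with $1\le a_1<\dots<a_l\le m$, the Schubert cycle is $S_\alpha=\{W\in G(l,m):\dim(W\cap A_{a_i})\ge i\ \forall i\}$; a Schubert union is a finite (possibly empty) union $S_U$ of Schubert cycles. $J_r$ is the maximum number of points in a Schubert union spanning a linear space of codimension at least $r$ in $\mathbf P^{k-1}$ ($J_0=n$); $J_r$ is computed by $S_U$ if $S_U$ is such a union with $J_r$ points. $D_r=n-J_r$, $D_0=0$, $E_r=D_r-D_{r-1}$. For fixed $(l,m,r)$ and all sufficiently large $q$, $E_r$ is given by a polynomial $E_r(q)$ in $q$. For $M\subset G(l,m)$, $D(M)$ is the set of $l$-dimensional subspaces $P\subset V^*$ whose common kernel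 $\bigcap_{h\in P}\ker h$ meets every $W\in M$ nontrivially; it is a subset of the Grassmannian $G(l,m)^*$ of $l$-dimensional subspaces of $V^*$, which is identified with a copy of $G(l,m)$ (using the flag of annihilators $A_m^\bot\subset\dots\subset A_1^\bot\subset V^*$). For a Schubert union $S_U$, $S_{U^*}=D(S_U)$, which is again a Schubert union. *)

(* Defs.v *)
From mathcomp Require Import all_boot all_order all_algebra.

Set Implicit Arguments.
Unset Strict Implicit.
Unset Printing Implicit Defensive.

Import GRing.Theory.
Local Open Scope ring_scope.

(* V is F^m (row vectors) with its standard basis, F a finite field and        *)
(* q = #|F|.  A subspace is represented by the unique canonical generator      *)
(* <<W>> = W : 'M[F]_m having it as row space, so that sets of subspaces are   *)
(* finite sets of matrices.  A functional h in V^* is also a row vector (its   *)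
(* coordinates in the dual basis), acting by v |-> v *m h^T.                   *)

Definition grass (l m : nat) (F : finFieldType) : {set 'M[F]_m} :=
  [set W | (<<W>>%MS == W) && (\rank W == l)].

Definition npoints (l m : nat) (F : finFieldType) : nat := #|grass l m F|.

(* Entries are numbered from 0: a tuple t stands for a_i = t_(i-1) + 1. *)
Definition schubert_index (l m : nat) : {set l.-tuple 'I_m} :=
  [set t : l.-tuple 'I_m | sorted ltn [seq val i | i <- t]].

(** Plücker embedding *)

Definition plucker_index (l m : nat) (j : 'I_('C(m, l))) : l.-tuple 'I_m :=
  enum_val (cast_ord (esym (card_ltn_sorted_tuples l m)) j).

(* When \rank W = l, this is row_base W up to a cast of dimensions. *)
Definition basis_mx (l m : nat) (F : finFieldType) (W : 'M[F]_m) : 'M[F]_(l, m) :=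
  conform_mx 0 (row_base W).

Definition plucker (l m : nat) (F : finFieldType) (W : 'M[F]_m) :
    'rV[F]_('C(m, l)) :=
  \row_j \det (colsub (tnth (plucker_index j)) (basis_mx l W)).

(* Linear subspaces of P^(k-1), k = 'C(m, l), are row spaces of matrices       *)
(* L : 'M[F]_k; the codimension is k - \rank L.                                *)

Definition linear_section (l m : nat) (F : finFieldType)
    (L : 'M[F]_('C(m, l))) : {set 'M[F]_m} :=
  [set W in grass l m F | (plucker l W <= L)%MS].

Definition plucker_span (l m : nat) (F : finFieldType) (X : {set 'M[F]_m}) :
    'M[F]_('C(m, l)) :=
  (\sum_(W in X) <<plucker l W>>)%MS.

(** Grassmann code and its higher weights *)

Definition grassmann_gen_mx (l m : nat) (F : finFieldType) :
    'M[F]_('C(m, l), npoints l m F) :=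
  \matrix_(i, j) plucker l (enum_val j) 0 i.

Definition code_support (n : nat) (F : finFieldType) (C : 'M[F]_n) : {set 'I_n} :=
  [set j | [exists c : 'rV[F]_n, (c <= C)%MS && (c 0 j != 0)]].

(* The default value n of the minimum is the length of the code; it is only    *)
(* used when there is no subcode of dimension r, i.e. when r > k.              *)
Definition higher_weight (l m : nat) (F : finFieldType) (r : nat) : nat :=
  \big[minn/npoints l m F]_(C : 'M[F]_(npoints l m F) |
      (C <= grassmann_gen_mx l m F)%MS && (\rank C == r)) #|code_support C|.

Definition H_ (l m : nat) (F : finFieldType) (r : nat) : nat :=
  npoints l m F - higher_weight l m F r.

Definition Delta_ (l m r : nat) (F : finFieldType) : int :=
  (higher_weight l m F r)%:Z - (higher_weight l m F r.-1)%:Z.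

Definition H_computed_by (l m : nat) (F : finFieldType) (r : nat)
    (X : {set 'M[F]_m}) : Prop :=
  exists L : 'M[F]_('C(m, l)),
    [/\ (\rank L + r = 'C(m, l))%N, X = linear_section L & #|X| = H_ l m F r].

(** Schubert unions *)

(* flag m F i is A_i, the span of the first i basis vectors. *)
Definition flag (m : nat) (F : finFieldType) (i : nat) : 'M[F]_m := pid_mx i.

(* dual_flag m F i is the annihilator of A_(m-i) in V^*, of dimension i. *)
Definition dual_flag (m : nat) (F : finFieldType) (i : nat) : 'M[F]_m :=
  kermx (flag m F (m - i))^T.

Definition schubert_cycle (l m : nat) (F : finFieldType) (A : nat -> 'M[F]_m)
    (a : l.-tuple 'I_m) : {set 'M[F]_m} :=
  [set W in grass l m F |
    [forall i : 'I_l, (i < \rank (W :&: A (tnth a i).+1)%MS)%N]].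

Definition schubert_unions (l m : nat) (F : finFieldType) (A : nat -> 'M[F]_m) :
    {set {set 'M[F]_m}} :=
  [set \bigcup_(a in U) schubert_cycle A a 
     | U : {set l.-tuple 'I_m} in powerset (schubert_index l m)].

Definition codim_ge (l m : nat) (F : finFieldType) (r : nat) (X : {set 'M[F]_m}) :
    bool :=
  (\rank (plucker_span l X) + r <= 'C(m, l))%N.

Definition J_ (l m : nat) (F : finFieldType) (r : nat) : nat :=
  \max_(X in schubert_unions l (flag m F) | codim_ge l r X) #|X|.

(* The flag A is a parameter so that this applies both to G(l,m) and, with     *)
(* dual_flag, to the Grassmannian of V^*; the identification of V^* with V     *)
(* carrying dual_flag to flag shows that both have the same maximum J_r.       *)
Definition J_computed_by (l m : nat) (F : finFieldType) (A : nat -> 'M[F]_m)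
    (r : nat) (X : {set 'M[F]_m}) : Prop :=
  [/\ X \in schubert_unions l A, codim_ge l r X & #|X| = J_ l m F r].

Definition D_ (l m : nat) (F : finFieldType) (r : nat) : int :=
  (npoints l m F)%:Z - (J_ l m F r)%:Z.

Definition E_ (l m r : nat) (F : finFieldType) : int :=
  D_ l m F r - D_ l m F r.-1.

(** Duality *)

(* kermx P^T is the common kernel of the functionals in P. *)
Definition dual (l m : nat) (F : finFieldType) (M : {set 'M[F]_m}) :
    {set 'M[F]_m} :=
  [set P in grass l m F | [forall W in M, (W :&: kermx P^T)%MS != 0]].

(** Assertions *)

Definition admissible (l m : nat) : bool := (1 <= l < m)%N.

Definition is_q_power (F : finFieldType) (x : int) : Prop :=
  exists i : nat, x = (#|F| ^ i)%N%:Z.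

(* f, as a function of q, is given by the polynomial p for all sufficiently    *)
(* large q; there is at most one such p.                                       *)
Definition given_by_poly (f : finFieldType -> int) (p : {poly rat}) : Prop :=
  exists q0 : nat, forall F : finFieldType, (q0 <= #|F|)%N ->
    (f F)%:~R = p.[#|F|%:R].

Definition reciprocal (N : nat) (p p' : {poly rat}) : Prop :=
  forall x : rat, x != 0 -> p.[x] = x ^+ N * p'.[x^-1].

Definition Q1 : Prop :=
  forall (l m : nat) (F : finFieldType) (r : nat), admissible l m ->
    (1 <= r <= 'C(m, l))%N ->
    exists e : r.-tuple nat, higher_weight l m F r = (\sum_(i <- e) #|F| ^ i)%N.

Definition Q2 : Prop :=
  forall (l m : nat) (F : finFieldType) (r : nat), admissible l m ->
    (1 <= r <= 'C(m, l))%N -> is_q_power F (Delta_ l m r F).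

Definition Q3 : Prop :=
  forall (l m r : nat) (p p' : {poly rat}), admissible l m ->
    (1 <= r <= 'C(m, l))%N ->
    given_by_poly (Delta_ l m r) p ->
    given_by_poly (Delta_ l m ('C(m, l).+1 - r)) p' ->
    reciprocal (l * (m - l)) p p'.

Definition Q4 : Prop :=
  forall (l m : nat) (F : finFieldType) (r : nat) (X : {set 'M[F]_m}),
    admissible l m -> (r <= 'C(m, l))%N ->
    H_computed_by l r X -> H_computed_by l ('C(m, l) - r) (dual l X).

Definition Q5 : Prop :=
  forall (l m : nat) (F : finFieldType) (r : nat), admissible l m ->
    (r <= 'C(m, l))%N -> J_ l m F r = H_ l m F r.

Definition Q7 : Prop :=
  forall (l m : nat) (F : finFieldType) (r : nat), admissible l m ->
    (1 <= r <= 'C(m, l))%N -> is_q_power F (E_ l m r F).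

Definition Q8 : Prop :=
  forall (l m : nat) (F : finFieldType) (r : nat) (X : {set 'M[F]_m}),
    admissible l m -> (r <= 'C(m, l))%N ->
    J_computed_by l (flag m F) r X ->
    J_computed_by l (dual_flag m F) ('C(m, l) - r) (dual l X).

Definition Q9 : Prop :=
  forall (l m r : nat) (p p' : {poly rat}), admissible l m ->
    (1 <= r <= 'C(m, l))%N ->
    given_by_poly (E_ l m r) p ->
    given_by_poly (E_ l m ('C(m, l).+1 - r)) p' ->
    reciprocal (l * (m - l)) p p'.

(* Main.v *)
Require Import Defs.
From mathcomp Require Import all_boot all_order all_algebra.
From mathcomp Require Import perm zify.

Set Implicit Arguments.
Unset Strict Implicit.
Unset Printing Implicit Defensive.

Import GRing.Theory.

(** All the counterexamples live in G(2,10), whose Plücker space has dimension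
    45, at r = 21, 22, 23.

    A Schubert union is a disjoint union of Schubert cells, and the indices of
    its cells form a lower ideal I of the Bruhat order.  The cell of index t is
    an affine space of dimension [cell_dim t] ([card_schubert_cell]), and the
    cells with index in I span the Plücker coordinates with index in I, no more
    and no less ([rank_plucker_span]).  So J_r is the maximum of the sum of
    q ^ [cell_dim t] over t in I, where I ranges over the lower ideals with at
    most k - r elements ([leq_J], [J_leq]): a purely combinatorial problem.

    For l = 2 a lower ideal is a shifted Young diagram, given by row lengths
    that decrease strictly until they vanish; row a, counted from 0, with x
    boxes contributes q^(2a) + ... + q^(2a + x - 1).  For m = 10 there are 512
    diagrams, and two families compete.  Among those with 24 boxes the best one
    has rows 9, 8, 7: the lines of P^9 meeting a fixed plane.  With fewer boxes
    this family loses its term in q^10, and it becomes better to enlarge the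
    diagram 6, 5, 4, 3, 2, 1 of a G(2,7), which has such a term and only 21
    boxes: for 23 and 22 boxes the rows 8, 5, 4, 3, 2, 1 and 7, 5, 4, 3, 2, 1
    are optimal ([J21], [J22], [J23]).  This holds for every q, because all the
    differences of polynomials pass a test that is sufficient for q >= 2
    ([gapP]).

    The jump from one family to the other gives E_22 = q^9 + q^8 - q^6, which
    refutes (Q7); under (Q5) the Delta_r are the E_r, so (Q2) fails with it.
    Within the second family E_23 = q^7.  The symmetry r -> 46 - r of (Q9) fixes
    23 and would turn q^7 into q^(16 - 7) = q^9.  Finally, the dual of the union
    computing J_23 lies, up to reversal of the basis, in the cells whose reversed
    indices are outside the ideal ([card_dual_leq]); these form the diagram
    9, 8, 6, a part of the first family's 9, 8, 7, and over F_2 they have 2539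
    points, less than J_22 = 2859. *)

Local Open Scope ring_scope.

(** * Indices of Schubert cycles *)

Section Index.
Variables l m : nat.
Implicit Types (s t : l.-tuple 'I_m) (i : 'I_l) (U : {set l.-tuple 'I_m}).

Definition bruhat_le s t : bool := [forall i, (tnth s i <= tnth t i)%N].

Definition lower_ideal U : {set l.-tuple 'I_m} :=
  [set s in schubert_index l m | [exists t in U, bruhat_le s t]].

Definition cell_dim t : nat := \sum_(i < l) (tnth t i - i).

Lemma schubert_indexP t :
  reflect (forall i j : 'I_l, (i < j)%N -> (tnth t i < tnth t j)%N)
          (t \in schubert_index l m).
Proof.
rewrite inE; apply: (iffP idP) => [st i j ij | lt_t].
  have := sorted_ltn_nth ltn_trans 0%N st i j.
  rewrite !inE size_map size_tuple !ltn_ord => /(_ isT isT ij).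
  by rewrite !(nth_map (tnth t i)) ?size_tuple // -!tnth_nth.
apply/(sortedP 0%N) => i; rewrite size_map size_tuple => lt_i.
have := lt_t (Ordinal (ltnW lt_i)) (Ordinal lt_i) (ltnSn i).
have := tnth t (Ordinal lt_i) => x0; rewrite !(tnth_nth x0) /=.
by rewrite !(nth_map x0) ?size_tuple ?(ltnW lt_i).
Qed.

Lemma tnth_schubert_le t i j :
  t \in schubert_index l m -> (tnth t i <= tnth t j)%N = (i <= j)%N.
Proof.
move=> /schubert_indexP lt_t.
case: (ltngtP i j) => [/lt_t/ltnW-> // | /lt_t | /val_inj->].
  by rewrite ltnNge => /negbTE.
exact: leqnn.
Qed.

Lemma tnth_schubert_inj t : t \in schubert_index l m -> injective (tnth t).
Proof.
move=> tI i j eq_ij; apply/val_inj/eqP.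
by rewrite eqn_leq -!(tnth_schubert_le _ _ tI) eq_ij leqnn.
Qed.

Lemma bruhat_le_anti s t : bruhat_le s t -> bruhat_le t s -> s = t.
Proof.
move=> /forallP st /forallP ts; apply: eq_from_tnth => i.
by apply/val_inj/eqP; rewrite eqn_leq st ts.
Qed.

Lemma lower_ideal_down U s t :
  s \in schubert_index l m -> bruhat_le s t -> t \in lower_ideal U -> s \in lower_ideal U.
Proof.
move=> sI le_st /setIdP[_ /existsP[a /andP[aU le_ta]]].
rewrite inE sI; apply/existsP; exists a; rewrite aU /=; apply/forallP => i.
exact: leq_trans (forallP le_st i) (forallP le_ta i).
Qed.

Lemma lower_ideal_sub U : lower_ideal U \subset schubert_index l m.
Proof. by apply/subsetP => t /setIdP[]. Qed.

(** Positions of the unconstrained entries of an echelon matrix with pivot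
    columns t: to the left of the pivot of their row, outside the pivot columns. *)
Definition free_entries t : {set 'I_l * 'I_m} :=
  [set u : 'I_l * 'I_m | (u.2 < tnth t u.1)%N && (u.2 \notin t)].

(** Row i has [tnth t i] columns to the left of its pivot, and exactly i of them
    are pivot columns, those of the previous rows. *)
Lemma card_free_entries t :
  t \in schubert_index l m -> #|free_entries t| = cell_dim t.
Proof.
move=> tI; rewrite -sum1_card.
rewrite (eq_bigl (fun u : 'I_l * 'I_m =>
  true && ((u.2 < tnth t u.1)%N && (u.2 \notin t)))); last by move=> u; rewrite inE.
rewrite -(pair_big_dep xpredT (fun (i : 'I_l) (j : 'I_m) => (j < tnth t i)%N && (j \notin t))
  (fun _ _ => 1%N)) /=.
apply: eq_bigr => i _; rewrite sum1dep_card.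
have card_lt : #|[set j : 'I_m | (j < tnth t i)%N]| = tnth t i.
  have le_m : (tnth t i <= m)%N by apply: ltnW.
  have inj : injective (widen_ord le_m) by move=> j k /(congr1 val) /= /val_inj.
  rewrite -[RHS]card_ord -(card_imset _ inj).
  apply: eq_card => j; rewrite inE; apply/idP/imsetP => [lt_j | [k _ ->]] //=.
  by exists (Ordinal lt_j) => //; apply: val_inj.
have card_piv : #|[set j : 'I_m | (j < tnth t i)%N] :&: [set j | j \in t]| = i.
  rewrite -[RHS](card_ord i).
  have le_l : (i <= l)%N by apply: ltnW.
  have inj : injective (fun k : 'I_i => tnth t (widen_ord le_l k)).
    by move=> j k /(tnth_schubert_inj tI)/(congr1 val) /= /val_inj.
  rewrite -(card_imset _ inj); apply: eq_card => j; rewrite !inE.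
  apply/andP/imsetP => [[lt_j /tnthP[k def_j]] | [k _ ->]] /=.
    move: lt_j; rewrite def_j ltnNge tnth_schubert_le // -ltnNge => lt_k.
    by exists (Ordinal lt_k) => //; congr tnth; apply: val_inj.
  by rewrite mem_tnth ltnNge tnth_schubert_le // -ltnNge /=.
rewrite -[X in (X - _)%N]card_lt -[X in (_ - X)%N]card_piv -cardsD.
by congr #|pred_of_set _|; apply/setP => j; rewrite !inE andbC; case: (j < _)%N.
Qed.

End Index.

(** * Row spaces and the standard flag *)

Section Matrices.
Variable F : finFieldType.

Lemma row_free_colsub (n p r : nat) (f : 'I_r -> 'I_p) (M : 'M[F]_(n, p)) :
  row_free (colsub f M) -> row_free M.
Proof.
move=> /row_freeP[B MfB]; apply/row_freeP; exists (colsub f 1%:M *m B).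
by rewrite mulmxA mulmx_colsub // mulmx1.
Qed.

Lemma row_free_rowsub (n p r : nat) (f : 'I_r -> 'I_n) (M : 'M[F]_(n, p)) :
  injective f -> row_free M -> row_free (rowsub f M).
Proof.
move=> f_inj M_free; rewrite rowsubE /row_free mxrankMfree //.
apply/row_freeP; exists (rowsub f 1%:M)^T.
by apply/matrixP => i j; rewrite -rowsubE !mxE (inj_eq f_inj) eq_sym.
Qed.

Lemma sub_flagP (n m b : nat) (B : 'M[F]_(n, m)) :
  reflect (forall x (j : 'I_m), (b <= j)%N -> B x j = 0) (B <= flag m F b)%MS.
Proof.
have flagE (i j : 'I_m) : flag m F b i j = ((i == j) && (i < b)%N)%:R by rewrite mxE.
apply: (iffP submxP) => [[D ->] x j le_bj | B0].
  rewrite mxE big1 // => k _; rewrite flagE.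
  by case: eqP => [->|]; rewrite ?mulr0 //= ltnNge le_bj mulr0.
exists B; apply/matrixP => x j; rewrite mxE (bigD1 j) //= big1 ?addr0.
  by rewrite flagE eqxx /=; case: ltnP => [_|/B0->]; rewrite ?mulr1 ?mul0r.
by move=> k /negbTE neq_kj; rewrite flagE neq_kj mulr0.
Qed.

End Matrices.

(** * Schubert cells *)

Section Cells.
Variables (l m : nat) (F : finFieldType).
Implicit Types (s t : l.-tuple 'I_m) (i : 'I_l) (j : 'I_m) (M : 'M[F]_(l, m)).

(** Reduced echelon form with the pivot as the last nonzero entry of its row,
    in accordance with a flag spanned by the first basis vectors. *)
Definition echelon t : {set 'M[F]_(l, m)} :=
  [set M : 'M[F]_(l, m) | [forall i : 'I_l, forall j : 'I_m,
     (j \in t) || (tnth t i < j)%N ==> (M i j == (j == tnth t i)%:R)]].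

Definition schubert_cell t : {set 'M[F]_m} := [set <<M>>%MS | M in echelon t].

Lemma echelonP t M :
  reflect (forall i j, (j \in t) || (tnth t i < j)%N -> M i j = (j == tnth t i)%:R)
          (M \in echelon t).
Proof.
rewrite inE; apply: (iffP forallP) => [H i j Hj | H i].
  by move/forallP/(_ j)/implyP/(_ Hj)/eqP: (H i).
by apply/forallP => j; apply/implyP => /H ->.
Qed.

Lemma echelon_colsub t M :
  t \in schubert_index l m -> M \in echelon t -> colsub (tnth t) M = 1%:M.
Proof.
move=> tI /echelonP H; apply/matrixP => i j; rewrite !mxE H ?mem_tnth //.
by rewrite (inj_eq (tnth_schubert_inj tI)) eq_sym.
Qed.

Lemma echelon_row_free t M :
  t \in schubert_index l m -> M \in echelon t -> row_free M.
Proof.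
move=> tI Mt; apply: (row_free_colsub (f := tnth t)).
by rewrite echelon_colsub // row_free_unit unitmx1.
Qed.

Lemma grass_genmx M : row_free M -> <<M>>%MS \in grass l m F.
Proof. by rewrite inE genmx_id eqxx /= mxrank_gen. Qed.

Lemma schubert_cell_grass t :
  t \in schubert_index l m -> schubert_cell t \subset grass l m F.
Proof.
move=> tI; apply/subsetP => _ /imsetP[M Mt ->].
exact/grass_genmx/(echelon_row_free tI).
Qed.

Lemma card_echelon t :
  t \in schubert_index l m -> #|echelon t| = (#|F| ^ cell_dim t)%N.
Proof.
move=> tI; rewrite -card_free_entries // -(card_pffun_on 0 _ (predT : {pred F})).
pose g (f : {ffun 'I_l * 'I_m -> F}) : 'M[F]_(l, m) :=
  \matrix_(i, j) (f (i, j) + (j == tnth t i)%:R).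
have g_inj : injective g.
  move=> f f' /matrixP eq_ff'; apply/ffunP => -[i j].
  by move: (eq_ff' i j); rewrite !mxE => /addIr.
rewrite -(card_imset _ g_inj); apply: eq_card => M.
apply/idP/imsetP => [/echelonP Mt | [f /pffun_onP[/subsetP f0 _] ->]].
  exists [ffun u => M u.1 u.2 - (u.2 == tnth t u.1)%:R]; last first.
    by apply/matrixP => i j; rewrite mxE ffunE subrK.
  apply/pffun_onP; split=> //; apply/subsetP => -[i j].
  apply: contraR; rewrite !inE negb_and negbK ffunE /= -leqNgt => Hij.
  rewrite Mt ?subrr //; case: (boolP (j \in t)) Hij => //= jt; rewrite orbF.
  rewrite leq_eqVlt => /orP[/eqP/val_inj eq_j|//].
  by rewrite -eq_j mem_tnth in jt.
apply/echelonP => i j Hij; rewrite mxE.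
suff -> : f (i, j) = 0 by rewrite add0r.
apply/eqP; case: eqP => // /eqP fij.
have /(f0 (i, j)) : (i, j) \in 0.-support f by [].
rewrite inE /= => /andP[lt_j jt]; case/orP: Hij => [|/ltnW]; first by rewrite (negbTE jt).
by rewrite leqNgt lt_j.
Qed.

Lemma echelon_genmx_inj t :
  t \in schubert_index l m -> {in echelon t &, injective (fun M => <<M>>%MS)}.
Proof.
move=> tI M N Mt Nt /genmxP/andP[/submxP[C MN] _].
have := echelon_colsub tI Mt; rewrite MN -mulmx_colsub (echelon_colsub tI Nt).
by rewrite mulmx1 => ->; rewrite mul1mx.
Qed.

Lemma card_schubert_cell t :
  t \in schubert_index l m -> #|schubert_cell t| = (#|F| ^ cell_dim t)%N.
Proof.
by move=> tI; rewrite card_in_imset ?card_echelon //; apply: echelon_genmx_inj.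
Qed.

(** W meets A_b in a space of dimension the number of pivots < b: the first i + 1
    rows of its echelon matrix lie in A_b as soon as the pivot of row i does, and
    conversely the coefficient of a row in a vector of W is read off at its pivot,
    so that only rows with pivot < b occur in vectors of A_b. *)
Lemma schubert_cell_cycle (t a : l.-tuple 'I_m) W :
  t \in schubert_index l m -> a \in schubert_index l m ->
  W \in schubert_cell t -> (W \in schubert_cycle (flag m F) a) = bruhat_le t a.
Proof.
move=> tI aI Wt; have Wgr := subsetP (schubert_cell_grass tI) _ Wt.
case/imsetP: Wt => M Mt defW.
have defWM : (W :=: M)%MS by rewrite defW; exact: genmxE.
rewrite inE Wgr /=; apply: eq_forallb => i; apply/idP/idP; last first.
  move=> le_ti.
  have le_l : (i.+1 <= l)%N by [].
  pose B := rowsub (widen_ord le_l) M.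
  have B_free : row_free B.
    apply: row_free_rowsub (echelon_row_free tI Mt).
    by move=> x y /(congr1 val) /= /val_inj.
  rewrite -(eqP B_free); apply: mxrankS; rewrite sub_capmx defWM rowsub_sub /=.
  apply/sub_flagP => x j lt_aj; rewrite mxE.
  have lt_tj : (tnth t (widen_ord le_l x) < j)%N.
    apply: leq_ltn_trans lt_aj; apply: leq_trans le_ti.
    by rewrite tnth_schubert_le // leq_ord.
  move/echelonP: Mt => ->; last by rewrite lt_tj orbT.
  by rewrite -val_eqE gtn_eqF.
rewrite [(tnth t i <= _)%N]leqNgt; apply: contraL => lt_ai; rewrite -leqNgt.
pose B : 'M_(i, m) := rowsub (widen_ord (ltnW (ltn_ord i))) M.
apply: leq_trans (rank_leq_row B); apply: mxrankS.
apply/rV_subP => u; rewrite sub_capmx defWM => /andP[/submxP[c defu] /sub_flagP u0].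
have c0 (k : 'I_l) : (i <= k)%N -> c 0 k = 0.
  move=> le_ik; rewrite -(u0 0 (tnth t k)); last first.
    by apply: leq_trans lt_ai _; rewrite tnth_schubert_le.
  have := congr1 (colsub (tnth t)) defu; rewrite -mulmx_colsub echelon_colsub //.
  by rewrite mulmx1 => /matrixP/(_ 0 k) <-; rewrite mxE.
rewrite defu; apply/submxP.
exists (colsub (widen_ord (ltnW (ltn_ord i))) c).
apply/rowP => j; rewrite !mxE (bigID (fun k : 'I_l => (k < i)%N)) /= addrC big1.
  by rewrite add0r (big_ord_narrow (ltnW (ltn_ord i))); apply: eq_bigr => k _; rewrite !mxE.
by move=> k; rewrite -leqNgt => /c0->; rewrite mul0r.
Qed.

Definition minor t M : F := \det (colsub (tnth t) M).

Lemma minorM t (C : 'M[F]_l) M : minor t (C *m M) = \det C * minor t M.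
Proof. by rewrite /minor -mulmx_colsub det_mulmx. Qed.

Lemma basis_mxP W : W \in grass l m F ->
  row_free (basis_mx l W) /\ <<basis_mx l W>>%MS = W.
Proof.
rewrite inE => /andP[/eqP defW /eqP rW]; rewrite /basis_mx.
have := row_base_free W; have := eq_row_base W; move: (row_base W).
rewrite rW => R eqR R_free; rewrite conform_mx_id; split=> //.
by rewrite -[RHS]defW; apply/eq_genmx.
Qed.

(** A nonzero minor has distinct columns, and sorting them changes only its
    sign; thus the column sum can be maximized over all tuples, without caring
    about order, and still be attained on an increasing one. *)
Lemma minor_sort M t : minor t M != 0 ->
  exists s, [/\ s \in schubert_index l m, minor s M != 0 &
                (\sum_(i < l) tnth s i = \sum_(i < l) tnth t i)%N].
Proof.
move=> nz_t.
have t_inj : injective (tnth t).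
  move=> i k eq_ik; apply/eqP; apply: contraNT nz_t => neq_ik.
  rewrite /minor -det_tr; apply/eqP; apply: (determinant_alternate neq_ik) => j.
  by rewrite !mxE eq_ik.
pose leI := (fun i j : 'I_m => (i <= j)%N).
have /tuple_permP[p def_s] : perm_eq (sort leI t) t by rewrite perm_sort.
exists [tuple tnth t (p i) | i < l]; split.
- rewrite inE ltn_sorted_uniq_leq map_inj_uniq; last exact: val_inj.
  rewrite -def_s sort_uniq; apply/andP; split; first exact/tuple_uniqP.
  by rewrite sorted_map; apply: sort_sorted => i j; apply: leq_total.
- rewrite /minor.
  have -> : colsub (tnth [tuple tnth t (p i) | i < l]) M = col_perm p (colsub (tnth t) M).
    by apply/matrixP => i j; rewrite !mxE tnth_mktuple.
  by rewrite col_permE det_mulmx mulf_neq0 // -unitfE -unitmxE unitmx_perm.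
rewrite [RHS](reindex_inj (@perm_inj _ p)) /=.
by apply: eq_bigr => i _; rewrite tnth_mktuple.
Qed.

(** Up to sign this minor of a matrix normalized at the columns t is the entry
    M i j, by Cramer's rule; only its nonvanishing matters. *)
Lemma minor_replace M t i j : colsub (tnth t) M = 1%:M -> M i j != 0 ->
  minor [tuple if k == i then j else tnth t k | k < l] M != 0.
Proof.
move=> /matrixP Mt nz_ij; apply/det0P => -[c /eqP c_nz c0]; case: c_nz.
have entry k n : M k (tnth t n) = (k == n)%:R by have := Mt k n; rewrite !mxE.
have c0_off n : n != i -> c 0 n = 0.
  move=> neq_ni; have /rowP/(_ n) := c0; rewrite !mxE (bigD1 n) //= big1.
    by rewrite !mxE tnth_mktuple (negbTE neq_ni) entry eqxx mulr1 addr0.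
  by move=> k /negbTE neq_kn; rewrite !mxE tnth_mktuple (negbTE neq_ni) entry neq_kn mulr0.
apply/rowP => n; rewrite mxE; have [->|/c0_off//] := eqVneq n i.
have /rowP/(_ i) := c0; rewrite !mxE (bigD1 i) //= big1 => [|k /c0_off->]; last exact: mul0r.
rewrite !mxE tnth_mktuple eqxx addr0 => /eqP.
by rewrite mulf_eq0 (negbTE nz_ij) orbF => /eqP.
Qed.

(** Take a nonzero minor whose columns have the largest possible sum and
    normalize it to the identity.  A nonzero entry to the right of a pivot would
    allow exchanging that pivot column for a later one, increasing the sum, so
    the normalized matrix is in echelon form. *)
Lemma grass_schubert_cell W : W \in grass l m F ->
  exists2 t, t \in schubert_index l m & W \in schubert_cell t.
Proof.
case/basis_mxP; move: (basis_mx l W) => B B_free defW.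
have B_full : row_full B^T by rewrite /row_full mxrank_tr.
have nz_t0 : minor [tuple fullrankfun B_full i | i < l] B != 0.
  rewrite /minor -det_tr -unitfE -unitmxE.
  have <- : rowsub (fullrankfun B_full) B^T =
            (colsub (tnth [tuple fullrankfun B_full i | i < l]) B)^T.
    by apply/matrixP => i j; rewrite !mxE tnth_mktuple.
  exact: fullrowsub_unit.
pose P t := minor t B != 0.
case: (@arg_maxnP _ _ P (fun t => \sum_(i < l) tnth t i)%N nz_t0) => t0 nz_t0' max_t0.
have [t [tI nz_t sum_t]] := minor_sort nz_t0'.
have Bt_unit : colsub (tnth t) B \in unitmx by rewrite unitmxE unitfE.
exists t => //; apply/imsetP; exists (invmx (colsub (tnth t) B) *m B); last first.
  by rewrite -defW; apply/eq_genmx/eqmx_sym/eqmxMfull; rewrite row_full_unit unitmx_inv.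
set M := invmx _ *m B.
have defB : B = colsub (tnth t) B *m M by rewrite mulKVmx.
have Mt : colsub (tnth t) M = 1%:M by rewrite -mulmx_colsub mulVmx.
apply/echelonP => i j /orP[/tnthP[k ->] | lt_tj].
  have /matrixP/(_ i k) := Mt; rewrite !mxE => ->.
  by rewrite (inj_eq (tnth_schubert_inj tI)) eq_sym.
rewrite -val_eqE gtn_eqF //; apply/eqP; apply: contraT => nz_ij.
have := minor_replace Mt nz_ij; set t' := mktuple _ => nz_t'.
have : P t' by rewrite /P defB minorM mulf_neq0.
move=> /max_t0; rewrite /geq /= -sum_t leqNgt => /negP[].
rewrite (bigD1 i) //= [X in (_ < X)%N](bigD1 i) //= tnth_mktuple eqxx.
rewrite [X in (_ < _ + X)%N](eq_bigr (fun k => tnth t k : nat)) ?ltn_add2r //.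
by move=> k /negbTE neq_ki; rewrite tnth_mktuple neq_ki.
Qed.

(** If the i-th chosen column lies to the right of the i-th pivot, then the first
    i + 1 rows vanish in all chosen columns from the i-th on: they are i + 1
    vectors in a space of dimension i. *)
Lemma echelon_minor s t M : s \in schubert_index l m -> t \in schubert_index l m ->
  M \in echelon t -> minor s M != 0 -> bruhat_le s t.
Proof.
move=> sI tI /echelonP Mt; rewrite /minor -unitfE -unitmxE => N_unit.
apply/forallP => i; rewrite leqNgt; apply/negP => lt_ti.
have le_l : (i.+1 <= l)%N by [].
pose N' := rowsub (widen_ord le_l) (colsub (tnth s) M).
have N'_free : row_free N'.
  apply: row_free_rowsub; last by rewrite row_free_unit.
  by move=> x y /(congr1 val) /= /val_inj.
have : (N' <= flag l F i)%MS.
  apply/sub_flagP => x j le_ij; rewrite !mxE.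
  have lt_tj : (tnth t (widen_ord le_l x) < tnth s j)%N.
    apply: leq_ltn_trans (leq_trans lt_ti _); rewrite tnth_schubert_le //.
    by rewrite leq_ord.
  by rewrite Mt ?lt_tj ?orbT // -val_eqE gtn_eqF.
move/mxrankS; rewrite (eqP N'_free) rank_pid_mx ?ltnn //; exact: ltnW.
Qed.

Definition coord_mx s : 'M[F]_(l, m) := rowsub (tnth s) 1%:M.

Lemma coord_echelon s : coord_mx s \in echelon s.
Proof. by apply/echelonP => i j _; rewrite !mxE eq_sym. Qed.

(** A nonvanishing minor of a submatrix of the identity bounds t by s, and its
    transpose bounds s by t. *)
Lemma minor_coord_eq0 s t : s \in schubert_index l m -> t \in schubert_index l m ->
  t != s -> minor t (coord_mx s) = 0.
Proof.
move=> sI tI; apply: contraNeq => nz_ts.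
have nz_st : minor s (coord_mx t) != 0.
  rewrite /minor -det_tr; congr (\det _ != 0): nz_ts.
  by apply/matrixP => i j; rewrite !mxE eq_sym.
by apply/eqP/bruhat_le_anti; apply: echelon_minor (coord_echelon _) _.
Qed.

Lemma plucker_index_in (j : 'I_('C(m, l))) : plucker_index j \in schubert_index l m.
Proof. exact: enum_valP. Qed.

Lemma plucker_index_inj : injective (@plucker_index l m).
Proof. by move=> i j /enum_val_inj/cast_ord_inj. Qed.

Lemma plucker_index_surj t : t \in schubert_index l m ->
  exists j : 'I_('C(m, l)), t = plucker_index j.
Proof.
move=> tI; exists (cast_ord (card_ltn_sorted_tuples l m) (enum_rank_in tI t)).
by rewrite /plucker_index cast_ordK enum_rankK_in.
Qed.

(** The basis chosen in the definition of [plucker] is replaced by any other one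
    at the cost of a nonzero scalar, the determinant of the base change. *)
Lemma plucker_genmx M : row_free M -> exists2 c : F, c != 0 &
  forall j : 'I_('C(m, l)), plucker l <<M>>%MS 0 j = c * minor (plucker_index j) M.
Proof.
move=> M_free; have [B_free] := basis_mxP (grass_genmx M_free).
set B := basis_mx _ _ => /genmxP/eqmxP eqBM.
have /eqmxMunitP[C C_unit defB] : (B == M)%MS by apply/eqmxP.
exists (\det C); first by rewrite -unitfE -unitmxE.
by move=> j; rewrite mxE -/B -minorM -defB.
Qed.

End Cells.

(** * Points and span of a Schubert union *)

Section Unions.
Variables (l m : nat) (F : finFieldType).
Implicit Types (s t : l.-tuple 'I_m) (i : 'I_l) (M : 'M[F]_(l, m)).
Implicit Types (U : {set l.-tuple 'I_m}).

Definition cell_sum (q : nat) (I : {set l.-tuple 'I_m}) : nat :=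
  (\sum_(t in I) q ^ cell_dim t)%N.

Lemma schubert_cell_disjoint s t : s \in schubert_index l m -> t \in schubert_index l m ->
  s != t -> [disjoint schubert_cell F s & schubert_cell F t].
Proof.
move=> sI tI; apply: contraNT => /pred0Pn[W /andP[/= Ws Wt]].
have le_refl u : bruhat_le u u by apply/forallP.
apply/eqP/bruhat_le_anti.
  by rewrite -(schubert_cell_cycle _ _ Ws) // (schubert_cell_cycle _ _ Wt).
by rewrite -(schubert_cell_cycle _ _ Wt) // (schubert_cell_cycle _ _ Ws).
Qed.

Lemma card_bigcup_cells (I : {set l.-tuple 'I_m}) : I \subset schubert_index l m ->
  #|\bigcup_(t in I) schubert_cell F t| = cell_sum #|F| I.
Proof.
move=> /subsetP sI; rewrite big_mkcond -sum1_card partition_disjoint_bigcup.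
  rewrite /cell_sum [RHS]big_mkcond; apply: eq_bigr => t _; case: ifP => [/sI tI|_].
    by rewrite sum1_card card_schubert_cell.
  by rewrite big_set0.
move=> s t neq_st; case: ifP => [/sI s_in|_]; last by rewrite disjoints_subset sub0set.
case: ifP => [/sI t_in|_]; last by rewrite disjoint_sym disjoints_subset sub0set.
exact: schubert_cell_disjoint.
Qed.

Definition schubert_union U : {set 'M[F]_m} :=
  \bigcup_(a in U) schubert_cycle (flag m F) a.

Lemma schubert_union_cells U : U \subset schubert_index l m ->
  schubert_union U = \bigcup_(t in lower_ideal U) schubert_cell F t.
Proof.
move=> /subsetP UI; apply/setP => W; apply/bigcupP/bigcupP.
  case=> a aU Wa; have Wgr : W \in grass l m F by case/setIdP: Wa.
  have [t tI Wt] := grass_schubert_cell Wgr; exists t => //; rewrite inE tI.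
  by apply/existsP; exists a; rewrite aU -(schubert_cell_cycle _ _ Wt) // UI.
case=> t; rewrite inE => /andP[tI /existsP[a /andP[aU le_ta]]] Wt.
by exists a => //; rewrite (schubert_cell_cycle _ _ Wt) // UI.
Qed.

Lemma card_schubert_union U : U \subset schubert_index l m ->
  #|schubert_union U| = cell_sum #|F| (lower_ideal U).
Proof.
by move=> UI; rewrite schubert_union_cells // card_bigcup_cells // lower_ideal_sub.
Qed.

Lemma sub_coord_mxP (n r : nat) (J : {set 'I_r}) (A : 'M[F]_(n, r)) :
  reflect (forall x j, j \notin J -> A x j = 0)
          (A <= rowsub (@enum_val _ (mem J)) 1%:M)%MS.
Proof.
apply: (iffP submxP) => [[D ->] x j Jj | A0].
  rewrite mxE big1 // => k _; rewrite !mxE.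
  case: eqP => [def_j|_]; last exact: mulr0.
  by rewrite -def_j enum_valP in Jj.
exists (colsub (@enum_val _ (mem J)) A); apply/matrixP => x j; rewrite !mxE.
have [Jj|Jj] := boolP (j \in J); last first.
  rewrite A0 // big1 // => k _; rewrite !mxE; case: eqP => [def_j|_]; last exact: mulr0.
  by rewrite def_j A0 ?mul0r.
rewrite (bigD1 (enum_rank_in Jj j)) //= big1 ?addr0 => [|k neq_k].
  by rewrite !mxE enum_rankK_in // eqxx mulr1.
rewrite !mxE; case: eqP => [def_j|_]; last exact: mulr0.
by case/eqP: neq_k; apply: enum_val_inj; rewrite enum_rankK_in.
Qed.

(** Plücker coordinates outside the ideal vanish on each of its cells by
    [echelon_minor], and each coordinate point of the ideal is the image of the
    subspace spanned by the corresponding basis vectors of V. *)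
Lemma rank_plucker_span U : U \subset schubert_index l m ->
  \rank (plucker_span l (schubert_union U)) = #|lower_ideal U|.
Proof.
move=> UI; pose J := [set j | plucker_index j \in lower_ideal U].
have <- : #|J| = #|lower_ideal U|.
  rewrite -(card_imset _ (@plucker_index_inj l m)); apply: eq_card => t.
  apply/imsetP/idP => [[j] | tU]; first by rewrite inE => ? ->.
  have [j def_t] := plucker_index_surj (subsetP (lower_ideal_sub U) _ tU).
  by exists j; rewrite // inE -def_t.
pose E : 'M[F]_(#|J|, _) := rowsub (@enum_val _ (mem J)) 1%:M.
have E_free : row_free E.
  by apply: row_free_rowsub enum_val_inj _; rewrite row_free_unit unitmx1.
rewrite -(eqP E_free); apply/eqmx_rank/andP; split.
  apply/sumsmx_subP => W; rewrite schubert_union_cells // genmxE.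
  case/bigcupP => t tU /imsetP[M Mt ->]; have tI := subsetP (lower_ideal_sub U) _ tU.
  apply/sub_coord_mxP => x j; rewrite ord1 {x} inE; apply: contraNeq.
  have [c _ ->] := plucker_genmx (echelon_row_free tI Mt).
  rewrite mulf_eq0 => /norP[_ /(echelon_minor (plucker_index_in j) tI Mt) le_jt].
  exact: lower_ideal_down (plucker_index_in j) le_jt tU.
apply/row_subP => k; rewrite row_rowsub rowE mulmx1.
have : enum_val k \in J := enum_valP k.
move: (enum_val k) => j; rewrite inE => jU.
have jI := plucker_index_in j.
have j_free := echelon_row_free jI (coord_echelon F (plucker_index j)).
apply: (sumsmx_sup <<coord_mx F (plucker_index j)>>%MS).
  rewrite schubert_union_cells //; apply/bigcupP; exists (plucker_index j) => //.
  by apply: imset_f; apply: coord_echelon.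
have [c nz_c plE] := plucker_genmx j_free.
rewrite genmxE; apply/submxP; exists (c^-1)%:M; apply/rowP => n.
rewrite mul_scalar_mx 2!mxE plE mulKf // eqxx /=.
have [->|neq_nj] := eqVneq n j.
  by rewrite /minor echelon_colsub ?coord_echelon // det1.
by rewrite minor_coord_eq0 ?plucker_index_in // (inj_eq (@plucker_index_inj l m)).
Qed.

Lemma codim_ge_union r U : U \subset schubert_index l m ->
  codim_ge l r (schubert_union U) = (#|lower_ideal U| + r <= 'C(m, l))%N.
Proof. by move=> UI; rewrite /codim_ge rank_plucker_span. Qed.

Lemma schubert_unionsP X :
  reflect (exists2 U : {set l.-tuple 'I_m},
             U \subset schubert_index l m & X = schubert_union U)
          (X \in schubert_unions l (flag m F)).
Proof.
apply: (iffP imsetP) => [[U] | [U UI ->]]; first by rewrite powersetE; exists U.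
by exists U; rewrite ?powersetE.
Qed.

Lemma leq_J r U : U \subset schubert_index l m ->
  (#|lower_ideal U| + r <= 'C(m, l))%N -> (cell_sum #|F| (lower_ideal U) <= J_ l m F r)%N.
Proof.
move=> UI codimU; rewrite -card_schubert_union //.
apply: (leq_bigmax_cond (schubert_union U)).
by rewrite codim_ge_union // codimU andbT; apply/schubert_unionsP; exists U.
Qed.

Lemma J_leq r b :
  (forall U : {set l.-tuple 'I_m}, U \subset schubert_index l m ->
     (#|lower_ideal U| + r <= 'C(m, l))%N -> (cell_sum #|F| (lower_ideal U) <= b)%N) ->
  (J_ l m F r <= b)%N.
Proof.
move=> le_b; apply/bigmax_leqP => X /andP[/schubert_unionsP[U UI ->]].
by rewrite codim_ge_union // card_schubert_union //; apply: le_b.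
Qed.

End Unions.

(** * Points of the dual of a Schubert union *)

Section Dual.
Variables (l m : nat) (F : finFieldType).
Implicit Types (s t : l.-tuple 'I_m) (U : {set l.-tuple 'I_m}).

(** Index of the cell, for the flag of the last basis vectors, obtained by
    reversing the basis. *)
Definition rev_index t : l.-tuple 'I_m := [tuple rev_ord (tnth t (rev_ord i)) | i < l].

Lemma rev_index_in t : t \in schubert_index l m -> rev_index t \in schubert_index l m.
Proof.
move=> /schubert_indexP lt_t; apply/schubert_indexP => i j lt_ij.
rewrite !tnth_mktuple /=.
have : (tnth t (rev_ord j) < tnth t (rev_ord i))%N.
  by apply: lt_t; have := ltn_ord j; rewrite /=; lia.
by have := ltn_ord (tnth t (rev_ord i)); lia.
Qed.

Definition rev_cols (n : nat) (A : 'M[F]_(n, m)) : 'M[F]_(n, m) := colsub (@rev_ord m) A.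

Lemma minor_rev_cols t (M : 'M[F]_(l, m)) :
  (minor (rev_index t) M == 0) = (minor t (rev_cols M) == 0).
Proof.
pose p : 'S_l := perm (@rev_ord_inj l).
have -> : minor (rev_index t) M = \det (col_perm p (colsub (tnth t) (rev_cols M))).
  by congr (\det _); apply/matrixP => i j; rewrite !mxE tnth_mktuple permE.
rewrite col_permE det_mulmx mulf_eq0 orbC; case: eqP => //= /eqP.
by rewrite -[_ == 0]negbK -unitfE -unitmxE unitmx_perm.
Qed.

(** Let P be in the dual and let t be the index of its cell after reversal of the
    coordinates, so that the minor of P at [rev_index t] is nonzero.  This minor
    is the determinant of the pairing of P with the coordinate subspace of index
    [rev_index t], which therefore misses the common kernel of P: it cannot
    belong to the Schubert union. *)
Lemma card_dual_leq U : U \subset schubert_index l m ->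
  (#|dual l (schubert_union F U)| <=
   cell_sum #|F| [set t in schubert_index l m | rev_index t \notin lower_ideal U])%N.
Proof.
move=> UI.
have sub : [set t in schubert_index l m | rev_index t \notin lower_ideal U]
   \subset schubert_index l m by apply/subsetP => t /setIdP[].
rewrite -card_bigcup_cells //.
pose g (P : 'M[F]_m) : 'M[F]_m := <<rev_cols P>>%MS.
have rev_colsK n : involutive (@rev_cols n).
  by move=> A; apply/matrixP => x y; rewrite !mxE rev_ordK.
have rev_colsE n (A : 'M_(n, m)) : rev_cols A = A *m rev_cols 1%:M.
  by rewrite /rev_cols mulmx_colsub // mulmx1.
have g_inj : {in grass l m F &, injective g}.
  move=> P Q; rewrite !inE => /andP[/eqP defP _] /andP[/eqP defQ _] /genmxP/eqmxP eqPQ.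
  rewrite -defP -defQ; apply: eq_genmx.
  rewrite -(rev_colsK _ P) -(rev_colsK _ Q) rev_colsE [X in (_ :=: X)%MS]rev_colsE.
  exact: eqmxMr.
rewrite -(card_in_imset (f := g)); last first.
  by move=> P Q /setIdP[Pgr _] /setIdP[Qgr _]; apply: g_inj.
apply/subset_leq_card/subsetP => _ /imsetP[P /setIdP[Pgr dualP] ->].
have [P_free defP] := basis_mxP Pgr; set B := basis_mx _ _ in P_free defP.
have gP : g P = <<rev_cols B>>%MS.
  rewrite /g -defP rev_colsE [in RHS]rev_colsE; apply: eq_genmx; apply: eqmxMr; exact: genmxE.
have revB_free : row_free (rev_cols B).
  by apply: (row_free_colsub (f := @rev_ord m)); rewrite -/(rev_cols _) rev_colsK.
have [t tI] := grass_schubert_cell (grass_genmx revB_free); rewrite -gP => gPt.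
apply/bigcupP; exists t => //; rewrite inE tI /=; apply/negP => rev_tU.
have nz_rev_t : minor (rev_index t) B != 0.
  case/imsetP: gPt => M Mt; rewrite gP => /genmxP/eqmxMunitP[C C_unit defB].
  rewrite minor_rev_cols defB minorM /minor echelon_colsub // det1 mulr1.
  by rewrite -unitfE -unitmxE.
have W_X : <<coord_mx F (rev_index t)>>%MS \in schubert_union F U.
  rewrite schubert_union_cells //; apply/bigcupP; exists (rev_index t) => //.
  by apply: imset_f; apply: coord_echelon.
have /rowV0Pn[u] := forall_inP dualP _ W_X; rewrite sub_capmx genmxE.
case/andP => /submxP[c ->] /sub_kermxP cP0 /eqP[].
suff -> : c = 0 by rewrite mul0mx.
have /submxP[D defB] : (B <= P)%MS by rewrite -defP genmxE.
have cB0 : c *m (colsub (tnth (rev_index t)) B)^T = 0.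
  have -> : (colsub (tnth (rev_index t)) B)^T = coord_mx F (rev_index t) *m B^T.
    by rewrite -rowsubE trmx_mxsub.
  by rewrite mulmxA defB trmx_mul mulmxA cP0 mul0mx.
have unit_c : (colsub (tnth (rev_index t)) B)^T \in unitmx.
  by rewrite unitmx_tr unitmxE unitfE.
by rewrite -(mulmxK unit_c c) cB0 mul0mx.
Qed.
End Dual.

Local Close Scope ring_scope.

(** * Lower ideals for l = 2 as shifted diagrams *)

Section Lines.
Variable m : nat.
Implicit Types (t : 2.-tuple 'I_m) (f : nat -> nat) (U : {set 2.-tuple 'I_m}).

Lemma ord2P (i : 'I_2) : {i = ord0} + {i = ord_max}.
Proof. by case: i => -[|[|//]] lt_i; [left | right]; apply: val_inj. Qed.

Definition lo t : nat := tnth t ord0.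
Definition hi t : nat := tnth t ord_max.

Lemma lo_lt t : lo t < m. Proof. exact: ltn_ord. Qed.
Lemma hi_lt t : hi t < m. Proof. exact: ltn_ord. Qed.

Lemma sum_schubert_index2 (G : nat -> nat -> nat) :
  \sum_(t in schubert_index 2 m) G (lo t) (hi t) =
  \sum_(a < m) \sum_(b < m | a < b) G a b.
Proof.
rewrite (pair_big_dep xpredT (fun a b : 'I_m => a < b) (fun a b : 'I_m => G a b)) /=.
rewrite (reindex (fun p : 'I_m * 'I_m => [tuple p.1; p.2])) /=.
  by apply: eq_bigl => p; rewrite inE /= andbT.
exists (fun t => (tnth t ord0, tnth t ord_max)) => [[a b] _ | t _] //.
by apply: eq_from_tnth => i; case: (ord2P i) => ->.
Qed.

Lemma schubert_index2E t : (t \in schubert_index 2 m) = (lo t < hi t).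
Proof.
apply/schubert_indexP/idP => [lt_t | lt_t i j]; first exact: lt_t.
by case: (ord2P i) => ->; case: (ord2P j) => ->.
Qed.

Lemma schubert_index2_lt t : t \in schubert_index 2 m -> lo t < hi t.
Proof. by rewrite schubert_index2E. Qed.

Lemma forall_ord2 (P : pred 'I_2) : [forall i, P i] = P ord0 && P ord_max.
Proof.
by apply/forallP/andP => [P_all | [P0 P1] i]; [split | case: (ord2P i) => ->].
Qed.

Lemma bruhat_le2 s t : bruhat_le s t = (lo s <= lo t) && (hi s <= hi t).
Proof. exact: forall_ord2. Qed.

Lemma cell_dim2 t : cell_dim t = lo t + (hi t).-1.
Proof.
rewrite /cell_dim big_ord_recr big_ord1 /= subn0 subn1.
by have -> : widen_ord (leqnSn 1) ord0 = ord0 by apply: val_inj.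
Qed.

(** The boxes of the shifted diagram whose row a has length f a. *)
Definition row_ideal f : {set 2.-tuple 'I_m} :=
  [set t in schubert_index 2 m | hi t - lo t <= f (lo t)].

Lemma sum_row_ideal f (G : nat -> nat -> nat) : (forall a, a < m -> a + f a < m) ->
  \sum_(t in row_ideal f) G (lo t) (hi t) =
  \sum_(a < m) \sum_(j < f a) G a (a + j.+1).
Proof.
move=> f_lt; rewrite (eq_bigl _ _ (in_set _)) big_mkcondr /=.
rewrite (sum_schubert_index2 (fun a b => if b - a <= f a then G a b else 0)).
apply: eq_bigr => a _; rewrite -big_mkcondr /=.
rewrite -(big_mkord (fun b => (a < b) && (b - a <= f a)) (G a)).
rewrite -(big_mkord xpredT (fun j => G a (a + j.+1))).
have lt_af := f_lt a (ltn_ord a).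
rewrite (big_cat_nat (leq0n a.+1)) //= big1_seq ?add0n; last first.
  move=> b /andP[/andP[lt_ab _]]; rewrite mem_index_iota; lia.
rewrite (big_cat_nat (n := (a + f a).+1)) //=; last lia.
rewrite [X in _ + X]big1_seq ?addn0; last first.
  move=> b /andP[/andP[_ lt_ab]]; rewrite mem_index_iota; lia.
rewrite -[X in \sum_(X <= _ < _ | _) _](add0n a.+1) big_addn subSS addKn.
rewrite big_nat_cond [RHS]big_nat_cond; apply: eq_big => [j|j _]; first by lia.
by rewrite addnC addSnnS.
Qed.

Definition row_len U a := \max_(t in U | lo t == a) (hi t - a).

Lemma row_len_lt U a : a < m -> a + row_len U a < m.
Proof.
move=> lt_am; have : row_len U a <= m.-1 - a; last by lia.
by apply/bigmax_leqP => t _; have := hi_lt t; lia.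
Qed.

(** An ideal that contains (a, b) contains (a, b') for all b' between a and b, so
    its rows have no holes. *)
Lemma row_ideal_len U : lower_ideal U = row_ideal (row_len (lower_ideal U)).
Proof.
apply/setP => t; apply/idP/setIdP => [tU | [tI]].
  split; first exact: subsetP (lower_ideal_sub U) _ tU.
  by apply: (leq_bigmax_cond t) => /=; rewrite tU eqxx.
apply: contraLR => tU; rewrite -ltnNge; have lt_t := schubert_index2_lt tI.
apply: (@leq_ltn_trans (hi t - lo t).-1); last by rewrite prednK ?subn_gt0.
apply/bigmax_leqP => s /andP[sU /eqP eq_st].
have : hi s < hi t; last by lia.
rewrite ltnNge; apply: contra tU => le_ts; apply: lower_ideal_down sU => //.
by rewrite bruhat_le2 le_ts -eq_st leqnn.
Qed.

(** If (a + 1, b) is in the ideal then so is (a, b), and b - a exceeds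
    b - (a + 1) by one. *)
Lemma row_len_decr U a : row_len (lower_ideal U) a.+1 <= (row_len (lower_ideal U) a).-1.
Proof.
apply/bigmax_leqP => t /andP[tU /eqP t0].
have tI := subsetP (lower_ideal_sub U) _ tU; have lt_t := schubert_index2_lt tI.
have lt_am : a < m by have := lo_lt t; lia.
pose s := [tuple Ordinal lt_am; tnth t ord_max].
have le_s : hi t - a <= row_len (lower_ideal U) a.
  have lo_s : lo s = a by [].
  have hi_s : hi s = hi t by [].
  rewrite -hi_s; apply: (leq_bigmax_cond s); rewrite lo_s eqxx andbT.
  apply: lower_ideal_down tU; first by rewrite schubert_index2E lo_s hi_s; lia.
  by rewrite bruhat_le2 lo_s hi_s leqnn andbT; lia.
lia.
Qed.

Lemma lower_row_ideal f : (forall a, f a.+1 <= (f a).-1) ->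
  lower_ideal (row_ideal f) = row_ideal f.
Proof.
move=> f_decr; have f_mono a d : 0 < f (a + d) -> f (a + d) + d <= f a.
  elim: d => [|d IHd]; first by rewrite !addn0.
  by rewrite addnS => fa_gt0; have := f_decr (a + d); lia.
apply/setP => s; rewrite inE; apply/andP/idP => [[sI /existsP[t /andP[]]] | sf]; last first.
  split; first by case/setIdP: sf.
  by apply/existsP; exists s; rewrite sf; apply/forallP.
case/setIdP => tI ft; rewrite bruhat_le2 => /andP[le0 le1].
rewrite inE sI /=; have lt_t := schubert_index2_lt tI; have lt_s := schubert_index2_lt sI.
by have := f_mono (lo s) (lo t - lo s); rewrite subnKC //; lia.
Qed.

End Lines.

(** * Comparing point counts for all q >= 2 *)

Section Coefficients.
Implicit Types u v s : seq nat.

(** Value at q of the polynomial with coefficients v, constant term first. *)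
Definition peval (q : nat) v : nat := foldr (fun c acc => c + q * acc) 0 v.

Fixpoint addp u v : seq nat :=
  match u, v with
  | [::], _ => v
  | _, [::] => u
  | c :: u', d :: v' => c + d :: addp u' v'
  end.

Lemma peval_addp q u v : peval q (addp u v) = peval q u + peval q v.
Proof.
by elim: u v => [|c u IHu] [|d v] //=; rewrite ?addn0 // IHu mulnDr addnACA.
Qed.

Lemma peval_nseq q n : peval q (nseq n 1) = \sum_(j < n) q ^ j.
Proof.
elim: n => [|n IHn]; first by rewrite big_ord0.
rewrite big_ord_recl /= IHn big_distrr; congr (_ + _).
by apply: eq_bigr => j _; rewrite expnS.
Qed.

Lemma peval_monomial q n : peval q (ncons n 0 [:: 1]) = q ^ n.
Proof. by elim: n => [|n IHn] /=; rewrite ?muln0 // add0n IHn expnS. Qed.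

Lemma pevalE q v : peval q v = head 0 v + q * peval q (behead v).
Proof. by case: v => //=; rewrite muln0. Qed.

(** The Horner scheme at 2 for the polynomial v - u, which fails as soon as a
    partial value is negative. *)
Fixpoint gap u v : option nat :=
  if u is c :: u' then
    if gap u' (behead v) is Some g then
      if c <= head 0 v + g.*2 then Some (head 0 v + g.*2 - c) else None
    else None
  else Some (peval 2 v).

Lemma leq_peval2 q v : 2 <= q -> peval 2 v <= peval q v.
Proof.
by move=> q_ge2; elim: v => //= c v IHv; rewrite leq_add2l leq_mul.
Qed.

(** If no partial value of the Horner scheme at 2 is negative, then each partial
    value at q >= 2 is at least the one at 2: the step x -> d + q x is monotone
    both in x >= 0 and in q. *)
Lemma gapP q u v g : 2 <= q -> gap u v = Some g -> peval q u + g <= peval q v.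
Proof.
move=> q_ge2; elim: u v g => [|c u IHu] v g /=.
  by case=> <-; apply: leq_peval2.
case def_g: gap => [g'|] //; case: ifP => // le_c [<-].
have {}IHu := IHu _ _ def_g; rewrite (pevalE q v).
have : q * peval q u + g'.*2 <= q * peval q (behead v).
  apply: leq_trans (leq_mul (leqnn q) IHu).
  by rewrite mulnDr leq_add2l -mul2n leq_mul2r q_ge2 orbT.
lia.
Qed.

Lemma mkseq_cons (T : Type) (f : nat -> T) n : mkseq f n.+1 = f 0 :: mkseq (f \o succn) n.
Proof. by rewrite /mkseq /= -[1]addn0 iotaDl -map_comp. Qed.

(** Moving from a row to the next one adds 2 to the dimensions of the cells, as
    both a and the first b increase by one. *)
Fixpoint shape_poly s : seq nat :=
  if s is x :: s' then addp (nseq x 1) [:: 0, 0 & shape_poly s'] else [::].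

Lemma peval_shape_poly q n f :
  peval q (shape_poly (mkseq f n)) = \sum_(a < n) \sum_(j < f a) q ^ (a.*2 + j).
Proof.
elim: n f => [|n IHn] f; first by rewrite big_ord0.
rewrite big_ord_recl mkseq_cons /=.
rewrite peval_addp /= IHn peval_nseq !add0n; congr (_ + _).
rewrite mulnA big_distrr; apply: eq_bigr => a _; rewrite big_distrr.
by apply: eq_bigr => j _; rewrite doubleS !addSn !expnS mulnA.
Qed.

(** All sequences of n row lengths, the first at most b, each one smaller than
    its predecessor unless that is 0, with at most k boxes; the bound k keeps the
    enumeration short. *)
Fixpoint shapes (n b k : nat) : seq (seq nat) :=
  if n is n'.+1 then
    flatten [seq [seq x :: s | s <- shapes n' x.-1 (k - x)] | x <- iota 0 (minn b k).+1]
  else [:: [::]].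

Lemma mem_shapes n b k f : f 0 <= b -> (forall a, f a.+1 <= (f a).-1) ->
  \sum_(a < n) f a <= k -> mkseq f n \in shapes n b k.
Proof.
elim: n b k f => [|n IHn] b k f // f0_b f_decr; rewrite big_ord_recl mkseq_cons => sum_k.
change (f 0 :: mkseq (f \o succn) n \in
  flatten [seq [seq x :: s | s <- shapes n x.-1 (k - x)] | x <- iota 0 (minn b k).+1]).
apply/flatten_mapP; exists (f 0).
  by rewrite mem_iota add0n ltnS leq_min f0_b (leq_trans (leq_addr _ _) sum_k).
apply/map_f/IHn => //=.
by rewrite leq_subRL ?(leq_trans (leq_addr _ _) sum_k).
Qed.

End Coefficients.

(** * Optimal Schubert unions in G(2,m) *)

Section Grass2.
Variable (m : nat).
Implicit Types s : seq nat.

Definition strict_shape s : bool :=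
  [&& size s == m, head 0 s < m & sorted (fun x y => y <= x.-1) s].

Definition shape_ideal s : {set 2.-tuple 'I_m} := row_ideal m (nth 0 s).

Lemma cell_sum_row_ideal q f : (forall a, a < m -> a + f a < m) ->
  cell_sum q (row_ideal m f) = peval q (shape_poly (mkseq f m)).
Proof.
move=> f_lt; rewrite /cell_sum peval_shape_poly.
rewrite (eq_bigr (fun t => (fun a b => q ^ (a + b.-1)) (lo t) (hi t))).
  rewrite (sum_row_ideal (fun a b => q ^ (a + b.-1))) //.
  by apply: eq_bigr => a _; apply: eq_bigr => j _; rewrite addnS /= addnA addnn.
by move=> t _; rewrite cell_dim2.
Qed.

Lemma card_row_ideal f : (forall a, a < m -> a + f a < m) ->
  #|row_ideal m f| = \sum_(a < m) f a.
Proof.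
move=> f_lt; rewrite -sum1_card (sum_row_ideal (fun _ _ => 1)) //.
by apply: eq_bigr => a _; rewrite sum1_card card_ord.
Qed.

Lemma strict_shape_decr s a : strict_shape s -> nth 0 s a.+1 <= (nth 0 s a).-1.
Proof.
case/and3P => _ _ /(sortedP 0) s_decr.
by case: (ltnP a.+1 (size s)) => [/s_decr|le_s] //; rewrite nth_default.
Qed.

Lemma strict_shape_lt s a : strict_shape s -> a < m -> a + nth 0 s a < m.
Proof.
move=> s_strict; have s_decr := strict_shape_decr _ s_strict; case/and3P: s_strict => _ + _.
rewrite -nth0; elim: a => [|a IHa] lt0 lt_am; first by rewrite add0n.
by have := IHa lt0 (ltnW lt_am); have := s_decr a; lia.
Qed.

Lemma cell_sum_shape_ideal q s : strict_shape s ->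
  cell_sum q (shape_ideal s) = peval q (shape_poly s).
Proof.
move=> s_strict; rewrite cell_sum_row_ideal; last by move=> a; apply: strict_shape_lt.
by case/and3P: s_strict => /eqP <- _ _; rewrite mkseq_nth.
Qed.

Lemma lower_shape_ideal s : strict_shape s -> lower_ideal (shape_ideal s) = shape_ideal s.
Proof. by move=> ss; apply: lower_row_ideal => a; apply: strict_shape_decr. Qed.

Lemma shape_ideal_sub s : shape_ideal s \subset schubert_index 2 m.
Proof. by apply/subsetP => t /setIdP[]. Qed.

Lemma card_shape_ideal s : strict_shape s -> #|shape_ideal s| = sumn s.
Proof.
move=> s_strict; rewrite card_row_ideal; last by move=> a; apply: strict_shape_lt.
case/and3P: s_strict => /eqP <- _ _.
by rewrite sumnE (big_nth 0) big_mkord.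
Qed.

(** Reduces an optimality that concerns all finite fields to one computation:
    every diagram with no more boxes than s is compared with s by [gap]. *)
Lemma J_grass2 (F : finFieldType) r s : strict_shape s -> sumn s + r = 'C(m, 2) ->
  all (fun u => isSome (gap (shape_poly u) (shape_poly s))) (shapes m m.-1 (sumn s)) ->
  J_ 2 m F r = peval #|F| (shape_poly s).
Proof.
move=> s_strict sum_s /allP best; apply/eqP; rewrite eqn_leq; apply/andP; split; last first.
  rewrite -(cell_sum_shape_ideal _ s_strict) -lower_shape_ideal //.
  by apply: leq_J; rewrite ?shape_ideal_sub // lower_shape_ideal // card_shape_ideal // sum_s.
apply: J_leq => U UI; rewrite -sum_s leq_add2r row_ideal_len.
set f := row_len _; have f_lt a : a < m -> a + f a < m by apply: row_len_lt.
rewrite cell_sum_row_ideal // card_row_ideal // => /(@mem_shapes m m.-1 _ f) in_shapes.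
have : mkseq f m \in shapes m m.-1 (sumn s).
  apply: in_shapes => [|a]; last exact: row_len_decr.
  have [m0|m_gt0] := posnP m; last by have := f_lt 0 m_gt0; lia.
  by rewrite /f /row_len big1 // => t _; have := hi_lt t; lia.
move/best; case def_g: gap => [g|] // _.
exact: leq_trans (leq_addr g _) (gapP (card_finNzRing_gt1 F) def_g).
Qed.

(** Reversal maps (a, b) to (m - 1 - b, m - 1 - a) and preserves b - a; the test
    says that s' describes the pairs whose reversal lies outside s. *)
Definition dual_shape s s' : bool :=
  all (fun a => all (fun b => (a < b) ==>
         ((b - a <= nth 0 s' a) == ~~ (b - a <= nth 0 s (m - b.+1)))) (iota 0 m)) (iota 0 m).

Lemma card_dual_shape (F : finFieldType) s s' : strict_shape s -> strict_shape s' ->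
  dual_shape s s' ->
  #|dual 2 (schubert_union F (shape_ideal s))| <= peval #|F| (shape_poly s').
Proof.
move=> s_strict s'_strict /allP compl.
apply: leq_trans (card_dual_leq F (shape_ideal_sub s)) _.
rewrite -cell_sum_shape_ideal // lower_shape_ideal // /cell_sum; apply/eq_leq/eq_bigl => t.
rewrite [RHS]inE [LHS]inE -/(lo t) -/(hi t); case: (boolP (t \in _)) => //= tI.
have lt_t := schubert_index2_lt tI.
have rev_tI := rev_index_in tI.
rewrite inE rev_tI /=.
have lo_rev : lo (rev_index t) = m - (hi t).+1.
  by rewrite /lo tnth_mktuple /hi /=; congr (m - (nat_of_ord (tnth t _)).+1); apply: val_inj.
have hi_rev : hi (rev_index t) = m - (lo t).+1.
  by rewrite /hi tnth_mktuple /lo /=; congr (m - (nat_of_ord (tnth t _)).+1); apply: val_inj.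
have -> : hi (rev_index t) - lo (rev_index t) = hi t - lo t.
  by rewrite lo_rev hi_rev; have := hi_lt t; lia.
rewrite lo_rev.
have := compl (lo t); rewrite mem_iota lo_lt => /(_ isT)/allP/(_ (hi t)).
by rewrite mem_iota hi_lt lt_t => /(_ isT)/eqP ->.
Qed.

End Grass2.

(** * The counterexamples in G(2,10) *)

(* Row lengths padded with zeros to ten rows; the shape optimal for J_r has
   45 - r boxes. *)
Definition shape21 := [:: 9; 8; 7; 0; 0; 0; 0; 0; 0; 0].
Definition shape22 := [:: 8; 5; 4; 3; 2; 1; 0; 0; 0; 0].
Definition shape23 := [:: 7; 5; 4; 3; 2; 1; 0; 0; 0; 0].

Lemma J21 (F : finFieldType) : J_ 2 10 F 21 = peval #|F| (shape_poly shape21).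
Proof. by apply: J_grass2 => //; vm_compute. Qed.

Lemma J22 (F : finFieldType) : J_ 2 10 F 22 = peval #|F| (shape_poly shape22).
Proof. by apply: J_grass2 => //; vm_compute. Qed.

Lemma J23 (F : finFieldType) : J_ 2 10 F 23 = peval #|F| (shape_poly shape23).
Proof. by apply: J_grass2 => //; vm_compute. Qed.

Local Open Scope ring_scope.

Lemma E_J l m r (F : finFieldType) : E_ l m r F = (J_ l m F r.-1)%:Z - (J_ l m F r)%:Z.
Proof. by rewrite /E_ /D_ opprB addrC addrA subrK. Qed.

(** Passing from 24 to 23 boxes changes the family of optimal diagrams, and the
    difference 2^9 + 2^8 - 2^6 lies strictly between 2^9 and 2^10. *)
Lemma not_Q7 : ~ Q7.
Proof.
move=> /(_ 2 10 'F_2 22 isT isT)[i].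
have -> : E_ 2 10 22 'F_2 = (2 ^ 9 + 2 ^ 8 - 2 ^ 6)%N%:Z.
  by rewrite E_J J21 J22 card_Fp //; vm_compute.
rewrite card_Fp // => -[].
have [le_i|lt_i] := leqP i 9.
  have := leq_pexp2l (isT : 0 < 2)%N le_i; lia.
have := leq_pexp2l (isT : 0 < 2)%N lt_i; lia.
Qed.

Lemma E23 (F : finFieldType) : E_ 2 10 23 F = (#|F| ^ 7)%N%:Z.
Proof.
rewrite E_J J22 J23.
have -> : shape_poly shape22 = addp (shape_poly shape23) (ncons 7 0%N [:: 1%N]) by [].
by rewrite peval_addp peval_monomial PoszD addrAC subrr add0r.
Qed.

Lemma not_Q9 : ~ Q9.
Proof.
have E23_poly : given_by_poly (E_ 2 10 23) 'X^7.
  by exists 0%N => F _; rewrite E23 hornerXn -pmulrn natrX.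
(* 45 + 1 - 23 = 23, so both polynomials are 'X^7; at 2 they give 2^7 and 2^9. *)
move=> /(_ 2 10 23 _ _ isT isT E23_poly E23_poly 2%:R isT).
by rewrite !hornerXn => /eqP; vm_compute.
Qed.

(** Over F_2 the dual of the union of shape 7, 5, 4, 3, 2, 1 is contained in one
    of shape 9, 8, 6, up to reversal, with 2539 points, whereas J_22 = 2859. *)
Lemma not_Q8 : ~ Q8.
Proof.
have s23 : strict_shape 10 shape23 by [].
move=> /(_ 2 10 'F_2 23 (schubert_union 'F_2 (shape_ideal 10 shape23)) isT isT)[].
  split.
  - by apply/schubert_unionsP; exists (shape_ideal 10 shape23); rewrite ?shape_ideal_sub.
  - by rewrite codim_ge_union ?shape_ideal_sub // lower_shape_ideal // card_shape_ideal.
  by rewrite J23 card_schubert_union ?shape_ideal_sub // lower_shape_ideal // cell_sum_shape_ideal.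
move=> _ _; rewrite -[('C(10, 2) - 23)%N]/22%N J22 => card_dual.
have := @card_dual_shape 10 'F_2 shape23 [:: 9; 8; 6; 0; 0; 0; 0; 0; 0; 0]%N s23 isT isT.
rewrite card_dual card_Fp; last by [].
by vm_compute.
Qed.

Lemma higher_weight_leq l m (F : finFieldType) r : (higher_weight l m F r <= npoints l m F)%N.
Proof. by rewrite /higher_weight; elim/big_rec: _ => // C x _ /(leq_trans (geq_minr _ _)). Qed.

(** By (Q5) the r-th higher weight is D_r, so that Delta_r = E_r. *)
Lemma Q2_Q5_Q7 : Q2 -> Q5 -> Q7.
Proof.
move=> q2 q5 l m F r lm rk; have := q2 l m F r lm rk; congr is_q_power.
have hwE i : (i <= 'C(m, l))%N -> (higher_weight l m F i)%:Z = D_ l m F i.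
  by move=> le_i; rewrite /D_ q5 // /H_ subzn ?leq_subr // subKn ?higher_weight_leq.
case/andP: rk => _ le_r.
by rewrite /Delta_ /E_ !hwE // (leq_trans (leq_pred r)).
Qed.

Theorem proposition6p2 :
  ~ Q7 /\ ~ Q8 /\ ~ Q9 /\ ~ (Q1 /\ Q2 /\ Q3 /\ Q4 /\ Q5).
Proof.
split; first exact: not_Q7.
split; first exact: not_Q8.
split; first exact: not_Q9.
by case=> _ [q2 [_ [_ q5]]]; apply/not_Q7/Q2_Q5_Q7.
Qed.
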